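(* Let $\mathcal{A}=((V_i)_{1\le i\le n},E)$ be an $n$-player arena (with a possibly infinite vertex set $V$), and let $T_1,\dots,T_n\subseteq V$ and $w_1,\dots,w_n\colon E\to\mathbb{N}$ be respectively targets and weight functions for each player. Let $\mathcal{G}=(\mathcal{A},(\mathsf{SPath}^{T_i}_{w_i})_{1\le i\le n})$ be the associated shortest-path game. Then there exists a Nash equilibrium in $\mathcal{G}$ from any initial vertex $v_0\in V$.
   Context: Arenas. An $n$-player arena ($n\ge 1$) is $\mathcal{A}=((V_i)_{1\le i\le n},E)$ where $V$ is a (possibly infinite) set of vertices, $(V_i)_{1\le i\le n}$ is a partition of $V$ (parts may be empty; $V_i$ is the set of vertices controlled by player $P_i$), $E\subseteq V\times V$, and every vertex has at least one $E$-successor. A play is an infinite sequence $v_0v_1\ldots$ with $(v_\ell,v_{\ell+1})\in E$ for all $\ell\in\mathbb{N}$; a history is a finite non-empty prefix of a play. Strategies. A strategy of $P_i$ is a function $\sigma_i$ mapping each history $h$ ending in $V_i$ to an $E$-successor of the last vertex of $h$. A strategy profile is a tuple $\sigma=(\sigma_i)_{1\le i\le n}$ with one strategy per player. A play $v_0v_1\ldots$ is consistent with $\sigma_i$ if $v_\ell\in V_i$ implies $v_{\ell+1}=\sigma_i(v_0\ldots v_\ell)$ for all $\ell$. $\mathsf{Out}(\sigma,v_0)$ is the unique play from $v_0$ consistent with all strategies of $\sigma$. Costs and equilibria. For a play $\pi=v_0v_1\ldots$, $\mathsf{SPath}^{T}_{w}(\pi)=\sum_{\ell=0}^{r-1}w(v_\ell,v_{\ell+1})$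 where $r=\min\{\ell\mid v_\ell\in T\}$ if this minimum exists, and $\mathsf{SPath}^{T}_{w}(\pi)=+\infty$ otherwise. Player $P_i$ aims to minimise $\mathsf{SPath}^{T_i}_{w_i}$. A strategy profile $\sigma$ is a Nash equilibrium from $v_0$ if no player has a strategy such that, when this player alone replaces their strategy in $\sigma$ by it, the outcome from $v_0$ has a strictly smaller cost for this player than $\mathsf{Out}(\sigma,v_0)$. *)

(* Defs.v *)
From mathcomp Require Import all_boot all_order all_algebra.
From mathcomp Require Import boolp classical_sets constructive_ereal.
Set Implicit Arguments.
Unset Strict Implicit.
Unset Printing Implicit Defensive.
Local Open Scope classical_set_scope.

                                                                            
Record arena (n : nat) (V : Type) := Arena {
  ctrl : 'I_n -> set V;
  edge : set (V * V);
  ctrl_disjoint : trivIset setT ctrl;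
  ctrl_cover : \bigcup_i ctrl i = setT;
  edge_total : forall v, exists v', edge (v, v') }.

Section Games.
Variables (n : nat) (V : Type).
Implicit Types (A : arena n V) (pi : nat -> V) (h : seq V).

Definition play A pi := forall l : nat, edge A (pi l, pi l.+1).

Definition history A h :=
  exists pi, play A pi /\ exists l : nat, h = mkseq pi l.+1.

                                                                        
                                                       
Record strategy A (i : 'I_n) := Strategy {
  move :> seq V -> V;
  moveP : forall h v, history A (rcons h v) -> ctrl A i v ->
    edge A (v, move (rcons h v)) }.

Definition profile A := forall i : 'I_n, strategy A i.

Definition consistent A i (s : strategy A i) pi :=
  forall l : nat, ctrl A i (pi l) -> pi l.+1 = s (mkseq pi l.+1).

Lemma has_owner A v : exists i, ctrl A i v.
Proof.
have : (\bigcup_i ctrl A i) v by rewrite ctrl_cover.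
by case=> i _; exists i.
Qed.

Definition owner A v : 'I_n := projT1 (cid (has_owner A v)).

Lemma ownerP A v : ctrl A (owner A v) v.
Proof. exact: projT2 (cid (has_owner A v)). Qed.

Lemma ctrl_owner A i v : ctrl A i v -> i = owner A v.
Proof.
move=> iv; apply: (ctrl_disjoint (a := A)) => //.
by exists v; split=> //; exact: ownerP.
Qed.

Fixpoint out_history A (s : profile A) (v0 : V) (l : nat) : seq V :=
  if l is l'.+1 then
    let h := out_history s v0 l' in rcons h (s (owner A (last v0 h)) h)
  else [:: v0].

                                                                       
                                                                
Definition outcome A (s : profile A) (v0 : V) : nat -> V :=
  fun l => last v0 (out_history s v0 l).

Lemma out_historyE A (s : profile A) v0 l :
  out_history s v0 l = mkseq (outcome s v0) l.+1.
Proof.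
by elim: l => [//|l IHl]; rewrite mkseqS -IHl /outcome /= last_rcons.
Qed.

Lemma outcome0 A (s : profile A) v0 : outcome s v0 0 = v0.
Proof. by []. Qed.

Lemma outcomeS A (s : profile A) v0 l :
  outcome s v0 l.+1 =
  s (owner A (outcome s v0 l)) (mkseq (outcome s v0) l.+1).
Proof. by rewrite -out_historyE /outcome /= last_rcons. Qed.

Lemma outcome_consistent A (s : profile A) v0 i :
  consistent (s i) (outcome s v0).
Proof. by move=> l /ctrl_owner ->; exact: outcomeS. Qed.

Lemma extend_history A pi l : (forall k, (k < l)%N -> edge A (pi k, pi k.+1)) ->
  history A (mkseq pi l.+1).
Proof.
move=> piE; pose nxt v := projT1 (cid (edge_total A v)).
pose rho k := if (k <= l)%N then pi k else iter (k - l) nxt (pi l).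
exists rho; split; last first.
  exists l; apply: (@eq_from_nth _ (pi 0)); rewrite !size_mkseq // => k kl.
  by rewrite !nth_mkseq // /rho -ltnS kl.
move=> k; rewrite /rho; case: (ltngtP k l) => [kl|lk|->].
- exact: piE.
- by rewrite subSn 1?ltnW //=; exact: projT2 (cid (edge_total A _)).
- by rewrite subSnn /=; exact: projT2 (cid (edge_total A _)).
Qed.

Lemma outcome_play A (s : profile A) v0 : play A (outcome s v0).
Proof.
move=> l; elim/ltn_ind: l => l /extend_history.
rewrite outcomeS mkseqS => hist; exact: moveP hist (ownerP A _).
Qed.

Lemma outcome_unique A (s : profile A) v0 pi :
  pi 0 = v0 -> (forall i, consistent (s i) pi) -> pi = outcome s v0.
Proof.
move=> pi0 piC; suff eqpi l : mkseq pi l.+1 = mkseq (outcome s v0) l.+1.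
  apply/funext => l; have /(congr1 (last v0)) := eqpi l.
  by rewrite !mkseqS !last_rcons.
elim: l => [|l IHl]; first by rewrite /mkseq /= pi0.
rewrite mkseqS [RHS]mkseqS IHl; congr rcons.
have pil : pi l = outcome s v0 l.
  by have /(congr1 (last v0)) := IHl; rewrite !mkseqS !last_rcons.
by rewrite outcomeS -pil -IHl; apply: piC; exact: ownerP.
Qed.

                                                                          
                               
Definition spath (T : set V) (w : V * V -> nat) pi : \bar int :=
  match pselect (exists l : nat, `[< T (pi l) >]) with
  | left reach => ((\sum_(l < ex_minn reach) w (pi l, pi l.+1))%N%:Z)%:E
  | right _ => +oo%E
  end.

                                                                          
Definition nash_equilibrium A (T : 'I_n -> set V) (w : 'I_n -> V * V -> nat)
    (s : profile A) (v0 : V) : Prop :=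
  ~ exists (i : 'I_n) (t : strategy A i),
      (spath (T i) (w i) (outcome (dfwith s t) v0)
         < spath (T i) (w i) (outcome s v0))%E.

End Games.

(* Main.v *)
Require Import Defs.
From mathcomp Require Import all_boot all_order all_algebra.
From mathcomp Require Import boolp classical_sets constructive_ereal.

(** In the zero-sum game of player [i] against the coalition of all the others,
    [i] has one positional strategy that is optimal from every vertex at once:
    whenever [i] can force a cost [< c], with [c] in [nat] or [+oo], it does.
    Let [pi] be the play where all players use these strategies.  From no vertex
    of [pi] can [i] force a cost smaller than that of the remaining suffix, so
    once [i] deviates, the coalition can keep its total cost at least that of
    [pi].  The coalition may have no optimal strategy when [V] is infinite, but
    the threat only has to enforce this fixed bound. *)

Set Implicit Arguments.
Unset Strict Implicit.
Unset Printing Implicit Defensive.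

(** * Order and well-foundedness of tree ordinals *)

(* Ordinals as well-founded trees: attractors in an infinitely branching arena
   have transfinite ranks. *)
Inductive ord := Sup (X : Type) (f : X -> ord).

Fixpoint ord_le (a b : ord) : Prop :=
  let: Sup X f := a in let: Sup Y g := b in
  forall x : X, exists y : Y, ord_le (f x) (g y).

Definition ord_lt (a b : ord) : Prop :=
  let: Sup Y g := b in exists y : Y, ord_le a (g y).

Lemma ord_le_refl a : ord_le a a.
Proof. by elim: a => X f IH x; exists x; exact: IH. Qed.

Lemma ord_le_trans a b c : ord_le a b -> ord_le b c -> ord_le a c.
Proof.
elim: a b c => X f IH [Y g] [Z h] /= ab bc x.
have [y xy] := ab x; have [z yz] := bc y.
by exists z; apply: IH xy yz.
Qed.

Lemma ord_lt_le_trans a b c : ord_lt a b -> ord_le b c -> ord_lt a c.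
Proof.
case: b c => [Y g] [Z h] /= [y ay] bc; have [z yz] := bc y.
by exists z; apply: ord_le_trans yz.
Qed.

Lemma ord_le_Sup X (f : X -> ord) b :
  (forall x, ord_lt (f x) b) -> ord_le (Sup f) b.
Proof. by case: b. Qed.

Lemma ord_ltNge a b : ~ ord_lt a b -> ord_le b a.
Proof.
elim: b a => Y g IH [X f] nab.
apply: ord_le_Sup => y; apply: contrapT => nlt; apply: nab; exists y.
apply: ord_le_Sup => x; apply: contrapT => /IH le_yx.
by apply: nlt; exists x.
Qed.

Lemma ord_lt_split a b c : ord_lt a c -> ord_lt a b \/ ord_lt b c.
Proof.
move=> ac; have [|/ord_ltNge cb] := pselect (ord_lt b c); first by right.
by left; apply: ord_lt_le_trans ac cb.
Qed.

Lemma ord_lt_wf : well_founded ord_lt.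
Proof.
suff H b : forall a, ord_le a b -> Acc ord_lt a.
  by move=> a; apply: (H a); exact: ord_le_refl.
elim: b => Y g IH a ab; constructor => x xa.
by have [y xy] := ord_lt_le_trans xa ab; apply: IH xy.
Qed.

(** * Cost bounds, ordered lexicographically with ranks *)

(* A cost bound; [None] stands for [+oo]. *)
Definition bound := option nat.

Definition bound_lt (c d : bound) : bool :=
  match c, d with
  | Some m, Some n => m < n
  | Some _, None => true
  | None, _ => false
  end.

Definition bound_sub (c : bound) (k : nat) : bound := omap (subn^~ k) c.

Lemma bound_lt_wf : well_founded bound_lt.
Proof.
have wf_Some m : Acc bound_lt (Some m).
  by elim/ltn_ind: m => m IH; constructor=> -[k /IH|].
by case=> [m|]; [|constructor=> -[k _|]].
Qed.

Lemma bound_lt_sub k c m : bound_lt (Some m) (bound_sub c k) =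
  bound_lt (Some (k + m)) c.
Proof. by case: c => //= c; rewrite ltn_subRL. Qed.

Lemma bound_subD c k m : bound_sub (bound_sub c k) m = bound_sub c (k + m).
Proof. by case: c => //= c; rewrite subnDA. Qed.

Definition lex_lt (x y : bound * ord) : Prop :=
  bound_lt x.1 y.1 \/ x.1 = y.1 /\ ord_lt x.2 y.2.

Lemma lex_lt_wf : well_founded lex_lt.
Proof.
move=> [c a]; elim/(well_founded_ind bound_lt_wf): c a => c IHc a.
elim/(well_founded_ind ord_lt_wf): a => a IHa.
by constructor=> -[c' a'] [/IHc|/= [->] /IHa].
Qed.

(** Negative transitivity: whatever lies below a minimal pair [z] also lies below any [y] that is
    not smaller than [z]. *)
Lemma lex_lt_split x y z : lex_lt x z -> lex_lt x y \/ lex_lt y z.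
Proof.
case: x y z => [c a] [c' a'] [c'' a''] [/= lt_c|/= [/= -> lt_a]].
  suff: bound_lt c c' \/ bound_lt c' c'' by case; [left; left|right; left].
  case: c c' c'' lt_c => [c|] [c'|] [c''|] //=; try by auto.
  by case: (ltnP c c') => [|/leq_ltn_trans H /H]; auto.
have [lt_c|nlt] := boolP (bound_lt c' c''); first by right; left.
have [lt_c|nlt'] := boolP (bound_lt c'' c'); first by left; left.
have -> : c' = c''.
  case: c' c'' nlt nlt' => [c'|] [c''|] //=; rewrite -!leqNgt => h1 h2.
  by congr Some; apply/eqP; rewrite eqn_leq h1 h2.
by have [] := ord_lt_split a' lt_a; [left|right]; right.
Qed.

(** Where subtraction leaves the bound unchanged, the rank still decreases. *)
Lemma lex_lt_sub c k a a' : ord_lt a' a -> lex_lt (bound_sub c k, a') (c, a).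
Proof.
case: c => [c|]; last by right.
rewrite /lex_lt /=; case: (ltnP (c - k) c) => [|le_c]; first by left.
have -> : c - k = c by apply/eqP; rewrite eqn_leq le_c leq_subr.
by right.
Qed.

Lemma lex_lt_ge_bound x y : ~ lex_lt x y ->
  forall m, bound_lt (Some m) y.1 -> bound_lt (Some m) x.1.
Proof.
case: x y => [[c|] a] [[d|] b] //= nlt m => [lt_d|_].
  by apply: leq_trans lt_d _; rewrite leqNgt; apply/negP=> ?; apply: nlt; left.
by case: nlt; left.
Qed.

Lemma wf_min (X : Type) (R : X -> X -> Prop) (P : X -> Prop) x :
  well_founded R -> P x -> exists y, P y /\ forall z, P z -> ~ R z y.
Proof.
move=> wfR; elim/(well_founded_ind wfR): x => x IH Px.
have [[y [Ryx Py]]|no] := pselect (exists y, R y x /\ P y);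
  first exact: IH Ryx Py.
by exists x; split=> // z Pz Rzx; apply: no; exists z.
Qed.

(** * Costs of finite prefixes of plays *)

Definition path_cost (V : Type) (w : V * V -> nat) (pi : nat -> V) (r : nat) :=
  \sum_(l < r) w (pi l, pi l.+1).

Lemma path_costS V (w : V * V -> nat) pi r :
  path_cost w pi r.+1 = path_cost w pi r + w (pi r, pi r.+1).
Proof. exact: big_ord_recr. Qed.

Lemma path_costD V (w : V * V -> nat) pi l r :
  path_cost w pi (l + r) =
  path_cost w pi l + path_cost w (fun k => pi (l + k)) r.
Proof.
rewrite /path_cost big_split_ord; congr (_ + _).
by apply: eq_bigr => k _ /=; rewrite addnS.
Qed.

Lemma eq_path_cost V (w : V * V -> nat) pi rho r :
  (forall k, k <= r -> pi k = rho k) -> path_cost w pi r = path_cost w rho r.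
Proof.
by move=> eq_pi; apply: eq_bigr => -[k kr] _; rewrite /= !eq_pi // ltnW.
Qed.

(** Here [c] is the cost of [pi]. Prefix costs never decrease, so visits to [T] after the first one
    also cost at least [c]. *)
Lemma spath_bound V (T : set V) (w : V * V -> nat) pi :
  exists c : bound,
    (forall r, T (pi r) -> ~~ bound_lt (Some (path_cost w pi r)) c) /\
    (forall rho, (spath T w rho < spath T w pi)%E ->
      exists r, T (rho r) /\ bound_lt (Some (path_cost w rho r)) c).
Proof.
rewrite {2}/spath; case: pselect => [reach|noreach]; last first.
  exists None; split=> [r Tr|rho]; first by case: noreach; exists r; apply/asboolP.
  rewrite /spath; case: pselect => // reach' _; exists (ex_minn reach').
  by case: ex_minnP => r /asboolP.
exists (Some (path_cost w pi (ex_minn reach))); split=> [r Tr|rho].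
  case: ex_minnP => l _ min_l; have lr : l <= r by apply/min_l/asboolP.
  by rewrite /= -leqNgt -(subnKC lr) path_costD leq_addr.
rewrite /spath; case: pselect => // reach' lt_cost; exists (ex_minn reach').
split; first by case: ex_minnP => r /asboolP.
by move: lt_cost; rewrite lte_fin ltz_nat.
Qed.

(** * One player against the coalition of the others *)

Section Attractor.
Variables (n : nat) (V : Type) (A : arena n V) (i : 'I_n).
Variables (T : set V) (w : V * V -> nat).

(* Player [i] can force a cost [< c] from [v], with rank at most [a].  Truncated
   subtraction is harmless: no vertex is winning for the bound [0]. *)
Inductive forces (a : ord) (c : bound) (v : V) : Prop :=
| forces_target of T v & bound_lt (Some 0) c
| forces_own a' v' of ctrl A i v & edge A (v, v') & ord_lt a' a
    & forces a' (bound_sub c (w (v, v'))) v'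
| forces_opp of ~ ctrl A i v & (forall v', edge A (v, v') ->
    exists2 a', ord_lt a' a & forces a' (bound_sub c (w (v, v'))) v').

Definition wins (c : bound) (v : V) := exists a, forces a c v.

Lemma wins_own c v v' : ctrl A i v -> edge A (v, v') ->
  wins (bound_sub c (w (v, v'))) v' -> wins c v.
Proof.
move=> iv vv' [a fa]; exists (Sup (fun _ : unit => a)).
by apply: forces_own iv vv' _ fa; exists tt; exact: ord_le_refl.
Qed.

(** If all successors were winning, the supremum of ranks chosen for them would serve as a rank for
    [v]. *)
Lemma not_wins_opp c v : ~ ctrl A i v -> ~ wins c v ->
  exists2 v', edge A (v, v') & ~ wins (bound_sub c (w (v, v'))) v'.
Proof.
move=> niv nwin; apply: contrapT => no; apply: nwin.
have rank v' : exists a, edge A (v, v') -> forces a (bound_sub c (w (v, v'))) v'.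
  (* [Sup (False_rect ord)] is the zero ordinal, a dummy rank for non-successors. *)
  have [vv'|] := pselect (edge A (v, v')); last by exists (Sup (False_rect ord)).
  have [[a fa]|nw] := pselect (wins (bound_sub c (w (v, v'))) v'); first by exists a.
  by case: no; exists v'.
have [f fP] := choice rank; exists (Sup f); apply: forces_opp => // v' vv'.
by exists (f v'); [exists v'; exact: ord_le_refl|exact: fP].
Qed.

(* The descent condition on a move, for all winning pairs [(c, a)] at once: it
   forces the move to be taken from a lexicographically least such pair. *)
Definition progress (v v' : V) := forall c a, forces a c v ->
  (T v /\ bound_lt (Some 0) c) \/
  exists c' a', [/\ lex_lt (c', a') (c, a), forces a' c' v' &
    forall m, bound_lt (Some m) c' -> bound_lt (Some (w (v, v') + m)) c].

Lemma progress_opp v v' : ~ ctrl A i v -> edge A (v, v') -> progress v v'.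
Proof.
move=> niv vv' c a [Tv c0|//|_ H]; first by left.
have [a' a'a fa'] := H _ vv'; right; exists (bound_sub c (w (v, v'))), a'.
by split=> // [|m]; [exact: lex_lt_sub|rewrite bound_lt_sub].
Qed.

Lemma progress_own v : ctrl A i v -> exists2 v', edge A (v, v') & progress v v'.
Proof.
move=> iv; have [v1 vv1] := edge_total A v.
have [[[c a] /= fa]|no] := pselect (exists x : bound * ord, forces x.2 x.1 v);
  last by exists v1 => // c a fa; case: no; exists (c, a).
have [[c0 a0] /= [f0 min0]] :=
  wf_min (P := fun x => forces x.2 x.1 v) (x := (c, a)) lex_lt_wf fa.
case: f0 => [Tv c0_gt0|a' v' _ vv' a'a fa'|//].
  (* Any move serves at a target: by minimality [d] is at least [c0], hence positive. *)
  exists v1 => // d b fb; left; split=> //.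
  exact: (lex_lt_ge_bound (min0 (d, b) fb)).
exists v' => // d b fb; right; exists (bound_sub c0 (w (v, v'))), a'.
have /= nlt := min0 (d, b) fb; split=> // [|m].
  by case: (lex_lt_split (d, b) (lex_lt_sub c0 (w (v, v')) a'a)).
by move=> lt_m; apply: (lex_lt_ge_bound nlt); rewrite -bound_lt_sub.
Qed.

(** Until a suitable target visit, each move lowers the pair of bound and rank, which cannot go on
    forever. *)
Lemma progress_reaches pi c :
  (forall l, progress (pi l) (pi l.+1)) -> wins c (pi 0) ->
  exists r, T (pi r) /\ bound_lt (Some (path_cost w pi r)) c.
Proof.
move=> piP [a]; move: {2}(c, a) (erefl (c, a)) => x.
elim/(well_founded_ind lex_lt_wf): x pi c a piP => x IH pi c a piP xE fa.
have [[T0 c0]|[c' [a' [lt' fa' le_c']]]] := piP 0 c a fa.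
  by exists 0; rewrite /path_cost big_ord0.
rewrite xE in lt'.
have [r [Tr ltr]] := IH _ lt' (fun l => pi l.+1) c' a' (fun l => piP l.+1) erefl fa'.
exists r.+1; split=> //; rewrite -add1n path_costD.
by rewrite {1}/path_cost big_ord1; exact: le_c' ltr.
Qed.

End Attractor.

(** * The equilibrium profile and its threats *)

Theorem theorem49 (n : nat) (n_ge1 : (1 <= n)%N) (V : Type) (A : arena n V)
    (T : 'I_n -> set V) (w : 'I_n -> V * V -> nat) (v0 : V) :
  exists s : profile A, nash_equilibrium T w s v0.
Proof.
pose win i := wins A i (T i) (w i).
(* One move serves all players: it is chosen for the owner of [v], and every edge is progress for
   the others. *)
have /choice [m mP] : forall v, exists v', edge A (v, v') /\
    forall i, progress A i (T i) (w i) v v'.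
  move=> v; pose j := owner A v.
  have [v' vv' own] := progress_own (T j) (w j) (ownerP A v).
  exists v'; split=> // i; have [iv|niv] := pselect (ctrl A i v).
    by rewrite (ctrl_owner iv).
  exact: progress_opp niv vv'.
pose pi l := iter l m v0.
have /choice [c cP] := fun i => spath_bound (T i) (w i) pi.
(* Otherwise the suffix of [pi], which follows [m], would reach the target with total cost below
   [c i]. *)
have pi_lose i l : ~ win i (bound_sub (c i) (path_cost (w i) pi l)) (pi l).
  rewrite -{2}[l]addn0 => /(progress_reaches (pi := fun k => pi (l + k))) [k|r].
    by rewrite addnS; have [_] := mP (pi (l + k)).
  rewrite bound_lt_sub -path_costD => -[/(cP i).1 /negP]; exact.
pose left i h := bound_sub (c i) (path_cost (w i) (nth v0 h) (size h).-1).
have /choice [pun punP] : forall ih : 'I_n * seq V, exists v',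
    let: (i, h) := ih in let v := last v0 h in
    edge A (v, v') /\ (~ ctrl A i v -> ~ win i (left i h) v ->
      ~ win i (bound_sub (left i h) (w i (v, v'))) v').
  move=> [i h]; have [v' vv'] := edge_total A (last v0 h).
  have [[niv nwin]|no] := pselect
      (~ ctrl A i (last v0 h) /\ ~ win i (left i h) (last v0 h)).
    by have [v1 ? ?] := not_wins_opp niv nwin; exists v1.
  by exists v'; split=> // niv nwin; case: no.
(* The first index where [h] leaves [pi], or [size h] if there is none. The owner of the preceding
   vertex is punished; index [0] never occurs in plays from [v0]. *)
pose dev h := find (fun k => `[< nth v0 h k <> pi k >]) (iota 0 (size h)).
pose mv h := if dev h == size h then m (last v0 h)
             else pun (owner A (nth v0 h (dev h).-1), h).
have mvP i h v : history A (rcons h v) -> ctrl A i v ->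
    edge A (v, mv (rcons h v)).
  move=> _ _; rewrite -{1}(last_rcons v0 h v) /mv; case: ifP => _.
    by have [] := mP (last v0 (rcons h v)).
  by have [] := punP (owner A (nth v0 (rcons h v) (dev (rcons h v)).-1), rcons h v).
pose s : profile A := fun i => Strategy (mvP i).
have mv_on rho l : (forall k, k <= l -> rho k = pi k) ->
    mv (mkseq rho l.+1) = m (pi l).
  move=> agree; rewrite /mv /dev size_mkseq hasNfind ?size_iota ?eqxx.
    by rewrite mkseqS last_rcons agree.
  apply/hasPn => k; rewrite mem_iota => /andP[_ kl].
  by apply/asboolPn; rewrite nth_mkseq // agree.
have mv_off rho d l : (forall k, k <= d -> rho k = pi k) ->
    rho d.+1 <> pi d.+1 -> d < l ->
    mv (mkseq rho l.+1) = pun (owner A (rho d), mkseq rho l.+1).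
  move=> agree differ dl; rewrite /mv.
  suff -> : dev (mkseq rho l.+1) = d.+1.
    by rewrite size_mkseq eqSS ltn_eqF //= nth_mkseq // ltnW.
  rewrite /dev size_mkseq; set a := fun k => _.
  have aE k : k <= l -> a k = `[< rho k <> pi k >].
    by move=> kl; rewrite /a nth_mkseq.
  have has_a : has a (iota 0 l.+1).
    by apply/hasP; exists d.+1; rewrite ?mem_iota // aE //; apply/asboolP.
  have := has_a; rewrite has_find size_iota => lt_find.
  have := nth_find 0 has_a; rewrite nth_iota // add0n aE // => /asboolP find_off.
  apply/eqP; rewrite eqn_leq; apply/andP; split; rewrite leqNgt; apply/negP.
    move=> /(before_find 0); rewrite nth_iota // add0n aE //.
    by move=> /asboolPn; exact.
  by rewrite ltnS => /agree.
have sE : outcome s v0 = pi.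
  by symmetry; apply: outcome_unique => // i l _; rewrite /= mv_on.
exists s => -[i [t]]; rewrite sE => /(cP i).2 [r [Tr lt_r]].
move: Tr lt_r; set rho := outcome _ v0 => Tr lt_r.
have rho_coalition l : ~ ctrl A i (rho l) -> rho l.+1 = mv (mkseq rho l.+1).
  move=> l_other; rewrite /rho outcomeS dfwith_out //.
  by apply/eqP => iE; apply: l_other; rewrite {1}iE; exact: ownerP.
(* Invariant of the deviating play: [i] cannot win within the remaining budget. At the target visit
   [r] it would win with rank zero. *)
suff /(_ r) lose l : ~ win i (bound_sub (c i) (path_cost (w i) rho l)) (rho l).
  apply: lose; exists (Sup (False_rect ord)); apply: forces_target => //.
  by rewrite bound_lt_sub addn0.
elim: l => [|l IH]; first by have := pi_lose i 0; rewrite /path_cost !big_ord0.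
have [agree|disagree] := pselect (forall k, k <= l.+1 -> rho k = pi k).
  by rewrite (eq_path_cost _ agree) agree.
rewrite path_costS -bound_subD; have [l_own|l_other] := pselect (ctrl A i (rho l)).
  by move=> win_l; apply: IH; apply: wins_own win_l => //; exact: outcome_play.
have /ex_minnP [] : exists k, `[< rho k <> pi k >].
  apply: contrapT => no; apply: disagree => k _.
  by apply: contrapT => off; apply: no; exists k; exact/asboolP.
case=> [/asboolP //|d] /asboolP differ min_d.
have agree k : k <= d -> rho k = pi k.
  by move=> kd; apply: contrapT => /asboolP /min_d; rewrite ltnNge kd.
(* Any other owner would have followed [m] at [d], so the coalition blames the right player. *)
have d_own : ctrl A i (rho d).
  by apply: contrapT => /rho_coalition; rewrite mv_on.
(* The vertex at [l] is not owned by [i], so the deviation is already visible in the history. *)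
have dl : d < l.
  rewrite ltnNge; apply/negP; rewrite leq_eqVlt => /predU1P [ld|ld].
    by apply: l_other; rewrite ld.
  by apply: disagree => k kl; apply: agree; exact: leq_trans kl ld.
have hist_cost :
    path_cost (w i) (nth v0 (mkseq rho l.+1)) l = path_cost (w i) rho l.
  by apply: eq_path_cost => k kl; rewrite nth_mkseq.
have := (punP (i, mkseq rho l.+1)).2.
rewrite /left size_mkseq hist_cost [in last _ _]mkseqS last_rcons => /(_ l_other IH).
by rewrite (ctrl_owner d_own) -(mv_off _ d) // -rho_coalition.
Qed.
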